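(* Let $X_1,X_2$ be disjoint bases of a graphic matroid $M$ of rank $r$. Then, for any $h\in X_1\cup X_2$, there exists a sequence of symmetric exchanges that transforms $(X_1,X_2)$ into $(X_2,X_1)$, has length $r$, and exchanges $h$ in the last step.
   Context: For a set $X$ and elements $e,f$, write $X-e+f=(X\setminus\{e\})\cup\{f\}$. For an ordered pair $(Z_1,Z_2)$ of bases of $M$, if $e\in Z_1\setminus Z_2$ and $f\in Z_2\setminus Z_1$ are such that $Z_1-e+f$ and $Z_2+e-f$ are both bases, then $(Z_1-e+f,\,Z_2+e-f)$ is obtained from $(Z_1,Z_2)$ by a symmetric exchange; the elements exchanged in this step are $e$ and $f$. The length of a sequence of symmetric exchanges is the number of exchanges in it. *)

(* Defs.v *)
From mathcomp Require Import all_boot.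

Set Implicit Arguments.
Unset Strict Implicit.
Unset Printing Implicit Defensive.

(** A finite matroid whose ground set is the whole finite type [E]. *)
Record matroid (E : finType) := Matroid {
  indep : {set {set E}};
  indep0 : set0 \in indep;
  indepS : forall A B : {set E}, A \subset B -> B \in indep -> A \in indep;
  indep_aug : forall A B : {set E}, A \in indep -> B \in indep -> #|A| < #|B| ->
    exists2 x, x \in B :\: A & x |: A \in indep
}.

Definition basis (E : finType) (M : matroid E) (B : {set E}) : bool :=
  maxset (fun A : {set E} => A \in indep M) B.

Definition rank (E : finType) (M : matroid E) : nat :=
  \max_(A in indep M) #|A|.

(** A finite undirected multigraph with edge set [E]: loops and parallel edges
    are allowed, and the order of the two components of [ends e] is irrelevant
    (see [joins]). *)
Record multigraph (V E : finType) := Multigraph { ends : E -> V * V }.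

Definition joins (V E : finType) (G : multigraph V E) (e : E) (u v : V) : bool :=
  (ends G e == (u, v)) || (ends G e == (v, u)).

(** The sequence [(v_1, e_1); ...; (v_k, e_k)] encodes the closed walk
    [v_1 e_1 v_2 e_2 ... v_k e_k v_1].  For [k = 1] this is a loop, for [k = 2]
    a pair of parallel edges. *)
Definition graph_cycle (V E : finType) (G : multigraph V E) (c : seq (V * E)) : bool :=
  [&& c != [::], uniq (unzip1 c), uniq (unzip2 c)
    & cycle (fun p q : V * E => joins G p.2 p.1 q.1) c].

Definition acyclic (V E : finType) (G : multigraph V E) (A : {set E}) : Prop :=
  forall c : seq (V * E), graph_cycle G c -> ~ {subset unzip2 c <= A}.

(** Since the edges of [G] are labelled by [E], being the cycle matroid of some
    [G] is the same as being isomorphic to the cycle matroid of some graph. *)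
Definition graphic (E : finType) (M : matroid E) : Prop :=
  exists (V : finType) (G : multigraph V E),
    forall A : {set E}, A \in indep M <-> acyclic G A.

(** [swap X e f] is [X - e + f]. *)
Definition swap (E : finType) (X : {set E}) (e f : E) : {set E} :=
  f |: (X :\ e).

Definition sym_exchange (E : finType) (M : matroid E)
    (Z : {set E} * {set E}) (e f : E) (Z' : {set E} * {set E}) : Prop :=
  [/\ basis M Z.1 /\ basis M Z.2,
      e \in Z.1 :\: Z.2 /\ f \in Z.2 :\: Z.1,
      basis M (swap Z.1 e f) /\ basis M (swap Z.2 f e)
    & Z' = (swap Z.1 e f, swap Z.2 f e)].

(** [exchange_seq M Z s Z']: performing in order the symmetric exchanges of the
    pairs [(e, f)] listed in [s] transforms [Z] into [Z']. *)
Fixpoint exchange_seq (E : finType) (M : matroid E)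
    (Z : {set E} * {set E}) (s : seq (E * E)) (Z' : {set E} * {set E}) : Prop :=
  if s is (e, f) :: s' then
    exists2 Y, sym_exchange M Z e f Y & exchange_seq M Y s' Z'
  else Z = Z'.

(* Main.v *)
Require Import Defs.
From mathcomp Require Import all_boot.
From mathcomp Require Import zify.

(** Since #|X1| = #|X2| = r and the bases are disjoint, a sequence of length r
reversing them moves every element exactly once.  The proof is an induction on r
in which one vertex of the graph is removed at each step.

Restrict attention to the edges of U = X1 :|: X2.  If U covers n vertices, then
n > r because the forest X1 alone covers more than r vertices, while the degrees
of the vertices add up to 4r, as U has 2r edges and no loops; so some covered vertex
has degree at most 2, or some vertex outside the edge h has degree at most 3
([low_degree_cut]): otherwise the degree sum would be at least 4n - 2 > 4r.  The
star of such a vertex meets every basis contained in U.  Only this property of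
the star is used afterwards, so it may be shrunk to a minimal set D that has it
(a cocircuit of the restriction to U).  D meets both X1 and X2, hence has two or
three elements, and in the latter case avoids h.

Minimality of D makes [mincut_basis] available: an independent subset of U of
size r - 1 that misses D becomes a basis when any element of D is added.  In
graph terms, when D is the star of v, a spanning tree of the graph without v can
be extended by any edge at v.  Take a in D and contract it.
- If D = {a, b} with a in X1 and b in X2, a sequence that reverses X1 - a and
  X2 - b in M / a can be performed in M, whichever of a and b is on either side.
  The exchange of a with b is then inserted at the end if h is one of a, b, and
  at the beginning otherwise ([reversal_cut2]).
- If D = {a, b, c} with a, b in X1 and c in X2, take a sequence that reverses
  X1 - a and X2 - c in M / a and ends with h.  Before b moves, add a to the side
  containing b and c to the other side; after b has moved, add c to the first
  side and a to the second.  The one step in which b is exchanged, say with f,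
  is replaced by two: c is exchanged with one of a and b, and f with the other
  ([two_exchanges]).  Here f comes last, so the last step still exchanges h.

Graphs enter only through [graph_like], two properties of the incidence between
edges and vertices that survive contraction ([graph_like_contract]) and that
suffice for the degree count. *)

Set Implicit Arguments.
Unset Strict Implicit.
Unset Printing Implicit Defensive.

(** * Incidence of edges and vertices *)

Definition vertices (V E : finType) (d : E -> {set V}) (A : {set E}) : {set V} :=
  \bigcup_(e in A) d e.

(** An interface between a matroid and a graph, given by the set [d e] of ends of
each edge (a singleton for a loop).  It holds for cycle matroids, and unlike the
description by cycles it passes to contractions by a direct argument.  The second
field says that a pendant edge closes no cycle, the third that a forest with k
edges covers at least k + 1 vertices. *)
Record graph_like (V E : finType) (d : E -> {set V}) (M : matroid E) : Prop := {
  graph_like_card : forall e, #|d e| <= 2;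
  graph_like_leaf : forall A e v, A \in indep M -> 1 < #|d e| ->
    v \in d e -> v \notin vertices d A -> e |: A \in indep M;
  graph_like_sparse : forall A, A \in indep M -> A != set0 ->
    #|A| < #|vertices d A|
}.

Lemma path_next (T : eqType) (R : rel T) x s p : path R x s -> p \in x :: s ->
  p = last x s \/ exists2 q, q \in x :: s & R p q.
Proof.
elim: s x => [|y s IH] x /=; first by rewrite inE => _ /eqP; left.
case/andP=> Rxy pth; rewrite inE => /predU1P[->|/IH].
  by right; exists y => //; rewrite !inE eqxx orbT.
case=> // [|[q qs Rpq]]; [by left | right].
by exists q => //; rewrite inE qs orbT.
Qed.

Section Multigraph.
Variables (V E : finType) (G : multigraph V E).

Definition endset (e : E) : {set V} := [set (ends G e).1; (ends G e).2].

Lemma joins_endset e u v : joins G e u v -> endset e = [set u; v].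
Proof. by rewrite /joins /endset => /orP[] /eqP -> //=; rewrite setUC. Qed.

Lemma endset_joins e u : u \in endset e -> exists v, joins G e u v.
Proof.
rewrite /joins /endset !inE; case: (ends G e) => x y /=.
by case/orP => /eqP ->; [exists y | exists x]; rewrite eqxx ?orbT.
Qed.

(** A cycle through [e], which is not a loop, leaves each end of [e] along a
second edge, so it cannot use [e] when one end of [e] is covered by no other
edge of the set. *)
Lemma acyclic_leaf A e v : acyclic G A -> 1 < #|endset e| ->
  v \in endset e -> v \notin vertices endset A -> acyclic G (e |: A).
Proof.
move=> acA e2 ve vA c cyc sub.
have [ec|enc] := boolP (e \in unzip2 c); last first.
  apply: (acA c cyc) => x xc; have := sub x xc.
  by rewrite !inE; case: eqP => //= xe; rewrite xe (negPf enc) in xc.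
have [[x e'] /= pc ee] := mapP ec; rewrite -{e'}ee in pc.
(* Rotate the cycle so that it starts with [e], traversed from [x]; the other edge
   of the cycle at [x] is then the last one, and the one at the opposite end of [e]
   is the second one. *)
have [i c' rotc] := rot_to pc.
case/and4P: cyc => _ uv ue cycR.
rewrite -(rot_cycle i) rotc in cycR.
have {}ue : uniq (unzip2 ((x, e) :: c')) by rewrite -rotc /unzip2 map_rot rot_uniq.
have subA q : q \in c' -> q.2 \in A.
  move=> qc; have /sub : q.2 \in unzip2 c.
    by apply: map_f; rewrite -(mem_rot i) rotc inE qc orbT.
  rewrite !inE; case: eqP => //= qe.
  by move: ue => /= /andP[]; rewrite -qe map_f.
have touch q : q \in c' -> v \notin endset q.2.
  move=> qc; apply: contra vA => vq.
  by apply/bigcupP; exists q.2 => //; apply: subA.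
case: c' => [|q c'] in ue rotc cycR subA touch *.
  move: cycR => /= /andP[/joins_endset /= de _].
  by move: e2; rewrite de setUid cards1.
have /= /andP[/joins_endset /= de pq] := cycR.
move: ve; rewrite de !inE => /orP[] /eqP vE.
  move: pq; rewrite rcons_path => /andP[_ /joins_endset /= dl].
  have := touch _ (mem_last q c'); by rewrite dl !inE vE eqxx orbT.
have := touch q; rewrite mem_head => /(_ isT).
by case: c' pq {ue rotc cycR subA touch} => [|q' c'] /= /andP[/joins_endset -> _];
  rewrite !inE vE eqxx.
Qed.

Lemma acyclic_endset A e : acyclic G A -> e \in A -> 1 < #|endset e|.
Proof.
move=> acA eA; rewrite /endset cards2; case: eqP => //= loop.
case: (acA [:: ((ends G e).1, e)]).
  by rewrite /graph_cycle /= andbT /joins {2}loop -surjective_pairing eqxx.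
by move=> x; rewrite inE => /eqP ->.
Qed.

(** Otherwise every walk can be continued by an edge different from the last one.
As there is no cycle, such a walk never meets its own vertices again, which a
finite graph does not allow. *)
Lemma acyclic_has_leaf A : acyclic G A -> A != set0 ->
  exists2 e, e \in A & exists2 v, v \in endset e & v \notin vertices endset (A :\ e).
Proof.
move=> acA /set0Pn[e0 e0A].
have [/exists_inP[e eA /exists_inP[v ve vA]]|noleaf] :=
    boolP [exists e in A, exists v in endset e, v \notin vertices endset (A :\ e)].
  by exists e => //; exists v.
have next e v : e \in A -> v \in endset e ->
    exists e', [/\ e' \in A, e' != e & v \in endset e'].
  move=> eA ve; have /exists_inPn/(_ v ve) := exists_inPn noleaf e eA.
  by rewrite negbK => /bigcupP[e']; rewrite in_setD1 => /andP[] ? ? ?; exists e'.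
pose R (p q : V * E) := joins G p.2 p.1 q.1.
(* The walk [x :: s] lists pairs of a vertex and the edge by which it is left.  The
   vertex to which the last edge leads is left open: if it is listed, it closes a
   cycle, and otherwise it prolongs the walk. *)
have trail k : exists x s, [/\ size s = k, path R x s, uniq (unzip1 (x :: s)) &
    uniq (unzip2 (x :: s)) /\
    forall p, p \in x :: s -> p.2 \in A /\ p.1 \in endset p.2].
  elim: k => [|k [x [s [sz pth uv [ue sA]]]]].
    exists ((ends G e0).1, e0), [::]; split=> //; split=> // p.
    by rewrite inE => /eqP -> /=; rewrite !inE eqxx.
  have [lA lE] := sA _ (mem_last x s).
  have [z lz] := endset_joins lE.
  have zl : z \in endset (last x s).2 by rewrite (joins_endset lz) !inE eqxx orbT.
  have [zs|zns] := boolP (z \in unzip1 (x :: s)).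
    have [[z' e1] /= zc zz] := mapP zs; rewrite -{z'}zz in zc.
    have [p1 [p2 cE]] : exists p1 p2, x :: s = p1 ++ (z, e1) :: p2.
      by case/splitPr: zc => p1 p2; exists p1, p2.
    have lE' : last x s = last (z, e1) p2.
      by rewrite -[LHS]/(last x (x :: s)) cE last_cat.
    (* The walk returns to the listed vertex [z]: its part from [z] on is a cycle. *)
    case: (acA ((z, e1) :: p2)).
      move: uv ue; rewrite cE /unzip1 /unzip2 !map_cat !cat_uniq.
      move=> /and3P[_ _ uv] /and3P[_ _ ue]; apply/and4P; split=> //=.
      rewrite rcons_path -lE' /R lz andbT.
      have : sorted R (x :: s) by [].
      by rewrite cE sorted_cat_cons => /andP[_ /=].
    move=> e /mapP[p pc ->]; apply: (sA p _).1.
    by rewrite cE mem_cat pc orbT.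
  have [e' [e'A e'n ze']] := next _ _ lA zl.
  exists x, (rcons s (z, e')); split.
  - by rewrite size_rcons sz.
  - by rewrite rcons_path pth.
  - by rewrite -rcons_cons /unzip1 map_rcons rcons_uniq zns.
  split; last first.
    move=> p; rewrite -rcons_cons mem_rcons inE => /predU1P[-> //|]; exact: sA.
  rewrite -rcons_cons /unzip2 map_rcons rcons_uniq ue andbT.
  apply/mapP => -[p pc /= pe].
  (* An edge used before the last one has both ends among the listed vertices,
     whereas [e'] has the new end [z]. *)
  have [pl|[q qc Rpq]] := path_next pth pc.
    by move: e'n; rewrite pe pl eqxx.
  move: ze'; rewrite pe (joins_endset Rpq) !inE => /orP[] /eqP zE;
    by move: zns; rewrite zE map_f.
have [x [s [sz _ /card_uniqP us _]]] := trail #|V|.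
have := max_card (mem (unzip1 (x :: s))).
by rewrite us /= size_map sz ltnn.
Qed.

(** Removing a leaf edge uncovers at least one vertex. *)
Lemma acyclic_sparse A : acyclic G A -> A != set0 -> #|A| < #|vertices endset A|.
Proof.
elim: {A}_.+1 {-2}A (ltnSn #|A|) => // n IH A szA acA A0.
have [e eA [v ve vA]] := acyclic_has_leaf acA A0.
have vE : vertices endset A = endset e :|: vertices endset (A :\ e).
  by rewrite /vertices (big_setD1 e).
have e2 := acyclic_endset acA eA.
have [A'0|A'0] := eqVneq (A :\ e) set0.
  by rewrite (cardsD1 e) eA A'0 cards0 vE (leq_trans e2) // subset_leq_card ?subsetUl.
have acA' : acyclic G (A :\ e).
  move=> c cc sub; apply: (acA c cc) => x /sub; exact: (subsetP (subsetDl _ _)).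
have szA' : #|A :\ e| < n by move: szA; rewrite (cardsD1 e) eA.
have lt' := IH _ szA' acA' A'0.
rewrite (cardsD1 e) eA add1n (leq_ltn_trans lt') // proper_card // properE vE subsetUr /=.
by apply/subsetPn; exists v => //; rewrite inE ve.
Qed.

End Multigraph.

(** * Bases, contractions and cuts of a matroid *)

Section MatroidBasics.
Variables (E : finType) (M : matroid E).
Implicit Types (A B Z U D : {set E}).

Lemma basis_indep B : basis M B -> B \in indep M.
Proof. exact: maxsetp. Qed.

Lemma indep_leq_basis A B : basis M B -> A \in indep M -> #|A| <= #|B|.
Proof.
move=> bB iA; rewrite leqNgt; apply/negP => ltBA.
have [x] := indep_aug (basis_indep bB) iA ltBA.
rewrite inE => /andP[xB _] ixB; case/negP: xB.
by rewrite -(maxsetsup bB ixB (subsetUr _ _)) setU11.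
Qed.

Lemma basisE A B : basis M B -> basis M A = (A \in indep M) && (#|A| == #|B|).
Proof.
move=> bB; apply/idP/andP => [bA|[iA /eqP szA]].
  by rewrite basis_indep // eqn_leq !indep_leq_basis ?basis_indep.
apply/maxsetP; split=> // C iC sAC; apply/esym/eqP.
by rewrite eqEcard sAC szA indep_leq_basis.
Qed.

Lemma basis_card A B : basis M A -> basis M B -> #|A| = #|B|.
Proof. by move=> bA bB; move: bA; rewrite (basisE _ bB) => /andP[_ /eqP]. Qed.

Lemma rank_basis B : basis M B -> rank M = #|B|.
Proof.
move=> bB; apply/eqP; rewrite eqn_leq; apply/andP; split.
  by apply/bigmax_leqP => A; apply: indep_leq_basis.
by rewrite /rank (bigD1 B) ?basis_indep //= leq_maxl.
Qed.

(** Contraction keeps the ground set [E]: the contracted element [a] becomes a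
loop instead of being removed, so that no change of type occurs in inductions. *)
Definition contract_indep (a : E) : {set {set E}} :=
  [set A : {set E} | (a \notin A) && (a |: A \in indep M)].

Lemma contract_indep0 a : [set a] \in indep M -> set0 \in contract_indep a.
Proof. by rewrite !inE setU0 => ->. Qed.

Lemma contract_indepS a A B :
  A \subset B -> B \in contract_indep a -> A \in contract_indep a.
Proof.
move=> sAB; rewrite !inE => /andP[aB iB].
by rewrite (contra (subsetP sAB a)) //= (indepS (setUS _ sAB)).
Qed.

Lemma contract_indep_aug a A B : A \in contract_indep a ->
  B \in contract_indep a -> #|A| < #|B| ->
  exists2 x, x \in B :\: A & x |: A \in contract_indep a.
Proof.
rewrite !inE => /andP[aA iA] /andP[aB iB] ltAB.
have [|x] := indep_aug iA iB; first by rewrite !cardsU1 aA aB ltn_add2l.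
rewrite !inE negb_or => /andP[/andP[xa xA]]; rewrite (negPf xa) /= => xB ix.
by exists x; rewrite !inE ?xA // setUCA ix negb_or eq_sym xa aA.
Qed.

Definition contract (a : E) (ia : [set a] \in indep M) : matroid E :=
  Matroid (contract_indep0 ia) (@contract_indepS a) (@contract_indep_aug a).

Lemma contract_basis a (ia : [set a] \in indep M) Z :
  basis (contract ia) Z = (a \notin Z) && basis M (a |: Z).
Proof.
apply/maxsetP/andP => [[]|[aZ /maxsetP[iZ maxZ]]].
  rewrite /= !inE => /andP[aZ iZ] maxZ; split=> //.
  apply/maxsetP; split=> // B iB sZB.
  have aB : a \in B by apply: (subsetP sZB); rewrite setU11.
  rewrite -(setD1K aB); congr (_ |: _); apply: maxZ.
    by rewrite !inE eqxx setD1K.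
  rewrite subsetD1 aZ andbT; apply: subset_trans sZB; exact: subsetUr.
rewrite /= !inE aZ iZ; split=> // B; rewrite inE => /andP[aB iB] sZB.
by rewrite -(setU1K aB) (maxZ _ iB) ?setUS // setU1K.
Qed.

(** The sets that meet every basis contained in [U]; the minimal ones are the
cocircuits of the restriction of the matroid to [U], when [U] contains a basis. *)
Definition cut (U D : {set E}) : bool :=
  [forall Q : {set E}, basis M Q ==> (Q \subset U) ==> ~~ [disjoint Q & D]].

Lemma cutP U D : reflect
  (forall Q, basis M Q -> Q \subset U -> exists2 x, x \in Q & x \in D) (cut U D).
Proof.
apply: (iffP forallP) => [cD Q bQ sQ|cD Q].
  have := cD Q; rewrite bQ sQ /= -setI_eq0 => /set0Pn[x].
  by rewrite inE => /andP[]; exists x.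
apply/implyP => bQ; apply/implyP => sQ; have [x xQ xD] := cD Q bQ sQ.
by rewrite -setI_eq0; apply/set0Pn; exists x; rewrite inE xQ.
Qed.

Definition mincut (U D : {set E}) : bool := minset (cut U) D.

(** As [D] is minimal, some basis [Q] inside [U] meets [D] in [d] only.
Augmenting [Z] from [Q] yields a basis inside [U]; it must meet [D], so the
element that was added is [d]. *)
Lemma mincut_basis U D d Z B : mincut U D -> basis M B -> Z \in indep M ->
  #|Z|.+1 = #|B| -> Z \subset U -> [disjoint Z & D] -> d \in D -> basis M (d |: Z).
Proof.
move=> mD bB iZ szZ sZU dZD dD.
have [cD minD] := minsetP mD.
have [Q [bQ sQ dQ]] : exists Q, [/\ basis M Q, Q \subset U & [disjoint Q & D :\ d]].
  have : ~~ cut U (D :\ d).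
    apply/negP => /minD; rewrite subsetDl => /(_ isT) /setP/(_ d).
    by rewrite !inE eqxx dD.
  rewrite negb_forall => /existsP[Q]; rewrite !negb_imply => /and4P[? ? ? _].
  by exists Q.
have [|x] := indep_aug iZ (basis_indep bQ); first by rewrite (basis_card bQ bB) -szZ.
rewrite inE => /andP[xZ xQ] ix.
have bx : basis M (x |: Z) by rewrite (basisE _ bB) ix cardsU1 xZ add1n szZ eqxx.
have [|y] := cutP _ _ cD _ bx.
  by rewrite subUset sub1set sZU andbT (subsetP sQ).
rewrite !inE => /predU1P[-> xD|yZ yD]; last by rewrite (disjointFr dZD yZ) in yD.
suff <- : x = d by [].
by apply/eqP; have := disjointFr dQ xQ; rewrite !inE xD andbT => /negbFE.
Qed.

End MatroidBasics.

(** * Contraction of an edge of a graph *)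

Section Contraction.
Variables (V E : finType) (d : E -> {set V}) (M : matroid E) (a : E) (u v : V).

Definition merge_to (x : V) : V := if x == v then u else x.

Lemma vertices_imset (f : V -> V) A :
  vertices (fun e => f @: d e) A = f @: vertices d A.
Proof.
apply/setP => y; apply/bigcupP/imsetP => [[e eA /imsetP[x xe ->]]|[x]].
  by exists x => //; apply/bigcupP; exists e.
by case/bigcupP => e eA xe ->; exists e => //; apply: imset_f.
Qed.

Lemma verticesU1 e A : vertices d (e |: A) = d e :|: vertices d A.
Proof.
have [eA|eA] := boolP (e \in A); last by rewrite /vertices big_setU1.
by rewrite (setUidPr _) ?sub1set // (setUidPr _) // /vertices (bigcup_sup e).
Qed.

(** Contracting the edge [a] identifies its ends [u] and [v].  A set that misses
[u] or [v] covers as many vertices as before.  If it covers both, one vertex is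
lost, but the set augmented by [a] covers the same vertices with one more edge,
which leaves room for the loss.  For a pendant edge [e] at the merged vertex, [e]
is pendant at one of [u], [v], and then [a] is pendant at the other one. *)
Lemma graph_like_contract (ia : [set a] \in indep M) : u != v -> d a = [set u; v] ->
  graph_like d M -> graph_like (fun e => merge_to @: d e) (contract ia).
Proof.
move=> uv da [dle2 leaf sparse].
have mergeu : merge_to u = u by rewrite /merge_to (negPf uv).
have mergev : merge_to v = u by rewrite /merge_to eqxx.
split=> [e|A e w|A].
- exact: leq_trans (leq_imset_card _ _) (dle2 e).
- rewrite !inE vertices_imset => /andP[aA iA] e2 /imsetP[x xe ->] wA.
  have de2 : 1 < #|d e| := leq_trans e2 (leq_imset_card _ _).
  have nA y : merge_to y = merge_to x -> y \notin vertices d A.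
    by move=> yx; apply: contra wA => yA; rewrite -yx imset_f.
  have dE p q : p != q -> p \in d e -> q \in d e -> d e = [set p; q].
    move=> pq pe qe; apply/esym/eqP.
    by rewrite eqEcard subUset !sub1set pe qe cards2 pq dle2.
  have uve : u \in d e -> v \in d e -> False.
    move=> ue ve; move: e2; rewrite (dE u v) //.
    by rewrite imsetU1 imset_set1 mergeu mergev setUid cards1.
  have -> : (a == e) = false.
    by apply/eqP => ae; apply: uve; rewrite -ae da !inE eqxx ?orbT.
  rewrite aA /=.
  have da2 : 1 < #|d a| by rewrite da cards2 uv.
  have iA' : A \in indep M by rewrite (indepS (subsetUr [set a] A)).
  have [/orP xuv|] := boolP ((x == u) || (x == v)); last first.
    rewrite negb_or => /andP[xu xv]; rewrite setUCA (leaf _ _ x) //.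
    by rewrite verticesU1 da !inE negb_or (nA x) // negb_or xu xv.
  have mx : merge_to x = u by case: xuv => /eqP ->.
  have nu : u \notin vertices d A by apply: nA; rewrite mx.
  have nv : v \notin vertices d A by apply: nA; rewrite mx.
  have iE : e |: A \in indep M by rewrite (leaf _ _ x) // nA.
  have [ue|nue] := boolP (u \in d e).
    apply: (leaf _ _ v) => //; first by rewrite da !inE eqxx orbT.
    by rewrite verticesU1 inE negb_or nv andbT; apply/negP; apply: uve.
  apply: (leaf _ _ u) => //; first by rewrite da !inE eqxx.
  by rewrite verticesU1 inE negb_or nu nue.
rewrite inE vertices_imset => /andP[aA iA] A0.
have iA' : A \in indep M by rewrite (indepS (subsetUr [set a] A)).
have ltA := sparse _ iA' A0.
set C := vertices d A in ltA *.
have mem_merge x : x \in C -> x != v -> x \in merge_to @: C.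
  by move=> xC xv; apply/imsetP; exists x; rewrite // /merge_to (negPf xv).
have [vC|vC] := boolP (v \in C); last first.
  apply: leq_trans ltA _; apply/subset_leq_card/subsetP => x xC.
  by apply: mem_merge => //; apply: contraNneq vC => <-.
have CvC : C :\ v \subset merge_to @: C.
  by apply/subsetP => x; rewrite !inE => /andP[xv xC]; apply: mem_merge.
have [uC|uC] := boolP (u \in C).
  have: #|a |: A| < #|vertices d (a |: A)|.
    by apply: sparse => //; apply/set0Pn; exists a; rewrite setU11.
  have dC : d a \subset C by rewrite da subUset !sub1set uC vC.
  rewrite verticesU1 (setUidPr dC) cardsU1 aA (cardsD1 v C) vC ltnS => lt.
  exact: leq_trans lt (subset_leq_card CvC).
have : #|u |: (C :\ v)| <= #|merge_to @: C|.
  rewrite subset_leq_card // subUset CvC andbT sub1set.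
  by apply/imsetP; exists v.
have uCv : u \notin C :\ v by rewrite !inE (negPf uC) andbF.
by rewrite cardsU1 uCv -[true]vC -cardsD1; apply: leq_trans.
Qed.

End Contraction.

(** * Small cuts from vertices of low degree *)

Section LowDegree.
Variables (V E : finType) (d : E -> {set V}) (M : matroid E).
Hypothesis glM : graph_like d M.

Lemma graph_like_endset A e : A \in indep M -> e \in A -> #|d e| = 2.
Proof.
move=> iA eA; apply/eqP; rewrite eqn_leq (graph_like_card glM) /=.
have ie : [set e] \in indep M by rewrite (indepS _ iA) ?sub1set.
have := graph_like_sparse glM ie; rewrite cards1 /vertices big_set1; apply.
by apply/set0Pn; exists e; rewrite set11.
Qed.

(** If a basis inside the union had no edge at [v], any edge of the union at [v]
would be pendant and could be added to it. *)
Lemma star_cut X1 X2 v : basis M X1 -> basis M X2 ->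
  v \in vertices d (X1 :|: X2) -> cut M (X1 :|: X2) [set e in X1 :|: X2 | v \in d e].
Proof.
move=> bX1 bX2 /bigcupP[e eU ve]; apply/cutP => Q bQ sQ.
have [/bigcupP[x xQ vx]|vQ] := boolP (v \in vertices d Q).
  by exists x => //; rewrite inE (subsetP sQ) ?vx.
have e2 : 1 < #|d e|.
  by move: eU; rewrite inE => /orP[] eX; rewrite (graph_like_endset _ eX) ?basis_indep.
have /(maxsetsup bQ) eQ := graph_like_leaf glM (basis_indep bQ) e2 ve vQ.
by exists e; rewrite ?inE ?ve ?andbT -?in_setU // -eQ ?setU11 ?subsetUr.
Qed.

(** Weigh each covered vertex by its degree, plus one if it is an end of [h].  The
total is at most 4r + 2, but there are at least r + 1 covered vertices, so some
weight is at most 3. *)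
Lemma low_degree_cut X1 X2 h : basis M X1 -> basis M X2 -> [disjoint X1 & X2] ->
  h \in X1 :|: X2 ->
  exists2 D : {set E}, cut M (X1 :|: X2) D &
    D \subset X1 :|: X2 /\ (#|D| <= 2 \/ #|D| <= 3 /\ h \notin D).
Proof.
move=> bX1 bX2 disX hU; set U := X1 :|: X2.
have dU2 e : e \in U -> #|d e| = 2.
  by rewrite inE => /orP[] eX; rewrite (graph_like_endset _ eX) ?basis_indep.
pose star v := [set e in U | v \in d e].
have [/exists_inP[v vU vlow]|high] :=
    boolP [exists v in vertices d U, #|star v| + (v \in d h) <= 3].
  exists (star v); [exact: star_cut | split].
    by apply/subsetP => e; rewrite inE => /andP[].
  move: vlow; have [vh|vh] := boolP (v \in d h) => vlow.
    by left; rewrite addn1 in vlow.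
  right; split; last by rewrite inE (negPf vh) andbF.
  by rewrite addn0 in vlow.
exfalso.
have hi v : v \in vertices d U -> 4 <= #|star v| + (v \in d h).
  by move=> vU; move/exists_inPn/(_ v vU): high; rewrite -ltnNge.
have sum_star : \sum_v (#|star v| + (v \in d h)) = 2 * #|U| + 2.
  rewrite big_split /=; congr (_ + _); last first.
    rewrite -(dU2 h hU) -sum1_card [RHS]big_mkcond /=.
    by apply: eq_bigr => v _; case: (v \in d h).
  under eq_bigr => v _ do rewrite -sum1_card.
  rewrite (exchange_big_dep (mem U)) /=; last by move=> v e _; rewrite inE => /andP[].
  rewrite mulnC -sum_nat_const; apply: eq_bigr => e eU.
  rewrite -(dU2 e eU) -sum1_card.
  by apply: eq_bigl => v; rewrite inE eU.
have sum_low : 4 * #|vertices d U| <= 2 * #|U| + 2.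
  rewrite -sum_star mulnC -sum_nat_const [in leqRHS](bigID (mem (vertices d U))) /=.
  by rewrite (leq_trans _ (leq_addr _ _)) // leq_sum.
have szX := basis_card bX1 bX2.
have szU : #|U| = 2 * #|X1|.
  by rewrite cardsU (disjoint_setI0 disX) cards0 subn0 -szX mul2n addnn.
have X1n0 : X1 != set0.
  rewrite -card_gt0 -(ltn_pmul2l (isT : 0 < 2)) muln0 -szU card_gt0.
  by apply/set0Pn; exists h.
have : #|X1| < #|vertices d U|.
  apply: leq_trans (graph_like_sparse glM (basis_indep bX1) X1n0) _.
  apply/subset_leq_card/bigcupsP => e eX; apply: bigcup_sup; by rewrite inE eX.
rewrite szU in sum_low; lia.
Qed.
End LowDegree.

(** * Sequences of exchanges *)

Section ExchangeSequences.
Variable E : finType.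
Implicit Types (M : matroid E) (s : seq (E * E)) (Z W : {set E} * {set E}).

Lemma exchange_seq_cat M Z W s t : exchange_seq M Z (s ++ t) W <->
  exists2 Y, exchange_seq M Z s Y & exchange_seq M Y t W.
Proof.
elim: s Z => [|[e f] s IH] Z /=; first by split=> [|[Y ->]] //; exists Z.
split=> [[Y ZY /IH[Y' YY' Y'W]]|[Y' [Y ZY YY'] Y'W]].
  by exists Y' => //; exists Y.
by exists Y => //; apply/IH; exists Y'.
Qed.

Lemma exchange_seq_swap M Z W s : exchange_seq M Z s W ->
  exchange_seq M (Z.2, Z.1) [seq (p.2, p.1) | p <- s] (W.2, W.1).
Proof.
elim: s Z => [|[e f] s IH] Z /=; first by move=> ->.
case=> Y [[b1 b2] [e12 f21] [b1' b2'] ->] /IH rest.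
by exists (swap Z.2 f e, swap Z.1 e f).
Qed.

Lemma sym_exchangeU1 M (P Q : {set E}) e f : e \notin P -> f \notin Q ->
  e \notin f |: Q -> f \notin e |: P ->
  basis M (e |: P) -> basis M (f |: Q) -> basis M (f |: P) -> basis M (e |: Q) ->
  sym_exchange M (e |: P, f |: Q) e f (f |: P, e |: Q).
Proof.
move=> eP fQ eQ fP b1 b2 b3 b4.
by split; rewrite /swap /= ?setU1K // !inE ?eqxx -?in_setU1 ?eQ ?fP.
Qed.

Lemma swapU1 (Z : {set E}) p e f : e != p -> swap (p |: Z) e f = p |: swap Z e f.
Proof.
rewrite eq_sym => pe; apply/setP => x; rewrite !inE.
by have [->|_] //= := eqVneq x p; rewrite pe orbT.
Qed.

(** When all exchanged elements lie in [K], the parts [N1] and [N2] of the two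
bases outside [K] never change.  The bases of [M'] that occur on each side are
thus known outside [K], and it suffices to extend those by [p] and [q]. *)
Lemma exchange_seq_lift M M' (K N1 N2 : {set E}) p q s Z W :
    p \notin K -> q \notin K ->
    (forall Y, Y :\: K = N1 -> basis M' Y -> basis M (p |: Y)) ->
    (forall Y, Y :\: K = N2 -> basis M' Y -> basis M (q |: Y)) ->
    {subset unzip1 s <= K} -> {subset unzip2 s <= K} ->
    Z.1 :\: K = N1 -> Z.2 :\: K = N2 -> exchange_seq M' Z s W ->
  exchange_seq M (p |: Z.1, q |: Z.2) s (p |: W.1, q |: W.2) /\
  (W.1 :\: K = N1 /\ W.2 :\: K = N2).
Proof.
move=> pK qK lp lq; elim: s Z => [|[e f] s IH] Z /= s1 s2 Z1 Z2; first by move=> <-.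
case=> Y [[b1 b2] [e12 f21] [b1' b2'] YE] rest.
have eK : e \in K by apply: s1; rewrite mem_head.
have fK : f \in K by apply: s2; rewrite mem_head.
have swapK (X : {set E}) g g' : g \in K -> g' \in K -> swap X g g' :\: K = X :\: K.
  move=> gK g'K; apply/setP => x; rewrite !inE.
  have [//|xK] := boolP (x \in K).
  have xn y : y \in K -> (x == y) = false by move=> yK; apply: contraNF xK => /eqP ->.
  by rewrite !xn.
have Y1 : Y.1 :\: K = N1 by rewrite YE swapK.
have Y2 : Y.2 :\: K = N2 by rewrite YE swapK.
have nK g g' : g \in K -> g' \notin K -> g != g'.
  by move=> gK; apply: contraNneq => <-.
have [] := IH Y _ _ Y1 Y2 rest.
- by move=> x xs; apply: s1; rewrite inE xs orbT.
- by move=> x xs; apply: s2; rewrite inE xs orbT.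
move=> rest' W12; split=> //; exists (p |: Y.1, q |: Y.2) => //.
rewrite YE; split; rewrite /= ?swapU1 ?nK //.
- by split; [apply: lp | apply: lq].
- move: e12 f21; rewrite !inE !negb_or => /andP[-> ->] /andP[-> ->].
  by rewrite !orbT !nK.
- by split; [apply: lp; rewrite // swapK | apply: lq; rewrite // swapK].
Qed.

Definition last_exchanges s (h : E) : Prop :=
  exists s' p, s = rcons s' p /\ (h = p.1 \/ h = p.2).

Lemma last_exchanges_cat s t h : last_exchanges t h -> last_exchanges (s ++ t) h.
Proof. by case=> t' [p [-> hp]]; exists (s ++ t'), p; rewrite rcons_cat. Qed.

Lemma last_exchanges_cons p s t h : last_exchanges (t ++ p :: s) h ->
  last_exchanges s h \/ s = [::] /\ (h = p.1 \/ h = p.2).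
Proof.
case/lastP: s => [|s q] [s' [p' []]].
  by rewrite cats1 => /rcons_inj[_ ->]; right.
by rewrite -rcons_cons -rcons_cat => /rcons_inj[_ ->] hp; left; exists s, p'.
Qed.

(** The last four conditions say that each element moves exactly once.  They give
the length of [s], and they survive the insertion of steps; in an induction they
show that a given element is exchanged in a single step. *)
Definition reversal M (X1 X2 : {set E}) s : Prop :=
  [/\ exchange_seq M (X1, X2) s (X2, X1), uniq (unzip1 s), uniq (unzip2 s),
      X1 =i unzip1 s & X2 =i unzip2 s].

Lemma reversal_swap M X1 X2 s :
  reversal M X1 X2 s -> reversal M X2 X1 [seq (p.2, p.1) | p <- s].
Proof.
case=> /exchange_seq_swap ex u1 u2 m1 m2.
have z1 : unzip1 [seq (p.2, p.1) | p <- s] = unzip2 s by rewrite /unzip1 -map_comp.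
have z2 : unzip2 [seq (p.2, p.1) | p <- s] = unzip1 s by rewrite /unzip2 -map_comp.
by rewrite /reversal z1 z2.
Qed.

Lemma last_exchanges_swap s h :
  last_exchanges s h -> last_exchanges [seq (p.2, p.1) | p <- s] h.
Proof.
case=> s' [p [-> hp]]; exists [seq (p.2, p.1) | p <- s'], (p.2, p.1).
by rewrite map_rcons; split=> //=; case: hp; [right | left].
Qed.

End ExchangeSequences.

(** * Reversing two bases across a small cut *)

Lemma setDD_eq0 (E : finType) (U D Y : {set E}) :
  Y :\: (U :\: D) = set0 -> Y \subset U /\ [disjoint Y & D].
Proof. by move/eqP; rewrite setD_eq0 subsetD => /andP[]. Qed.

Section Step.
Variables (E : finType) (M : matroid E) (X1 X2 : {set E}).
Hypotheses (bX1 : basis M X1) (bX2 : basis M X2) (disX : [disjoint X1 & X2]).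
Let U := X1 :|: X2.

Lemma notin_disjoint x : x \in X1 -> x \notin X2.
Proof. by move=> xX; rewrite (disjointFr disX). Qed.

(** A basis of the contraction that misses [D] has size r - 1, and any element of
[D] may take the place of [a]. *)
Lemma contract_basis_mincut a (ia : [set a] \in indep M) D p (Z : {set E}) :
  mincut M U D -> Z \subset U -> [disjoint Z & D] -> p \in D ->
  basis (contract ia) Z -> basis M (p |: Z).
Proof.
move=> mD sZ dZ pD; rewrite contract_basis => /andP[aZ baZ].
apply: (mincut_basis mD baZ) => //; last by rewrite cardsU1 aZ.
exact: indepS (subsetUr _ _) (basis_indep baZ).
Qed.

(** As all elements moved by [s] lie outside [{a, b}], every pair of bases that
occurs in [s] extends to bases of [M] by adding [a] and [b] in either order.  So
[s] lifts to [M], and [a] may be exchanged with [b] before or after it. *)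
Lemma reversal_cut2 a b (ia : [set a] \in indep M) s h :
  a \in X1 -> b \in X2 -> mincut M U [set a; b] ->
  reversal (contract ia) (X1 :\ a) (X2 :\ b) s ->
  (h \in [set a; b] \/ last_exchanges s h) ->
  exists t, reversal M X1 X2 t /\ last_exchanges t h.
Proof.
move=> aX bX mD [ex u1 u2 m1 m2] hs; set D := [set a; b] in mD hs.
have aX2 := notin_disjoint aX.
have bX1' : b \notin X1 by rewrite (disjointFl disX).
have ab : a != b by apply: contraNneq aX2 => ->.
pose K := U :\: D.
have lift p Y : p \in D -> Y :\: K = set0 -> basis (contract ia) Y -> basis M (p |: Y).
  by move=> pD /setDD_eq0[sY dY]; apply: contract_basis_mincut mD sY dY pD.
have subK1 : {subset unzip1 s <= K}.
  move=> x; rewrite -m1 !inE => /andP[xa xX]; rewrite xX (negPf xa) /= andbT.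
  by apply: contraNneq bX1' => <-.
have subK2 : {subset unzip2 s <= K}.
  move=> x; rewrite -m2 !inE => /andP[xb xX]; rewrite xX (negPf xb) /= orbT andbT orbF.
  by apply: contraNneq aX2 => <-.
have K1 : (X1 :\ a) :\: K = set0.
  by apply/eqP; rewrite setD_eq0; apply/subsetP => x; rewrite m1 => /subK1.
have K2 : (X2 :\ b) :\: K = set0.
  by apply/eqP; rewrite setD_eq0; apply/subsetP => x; rewrite m2 => /subK2.
have aD : a \in D by rewrite !inE eqxx.
have bD : b \in D by rewrite !inE eqxx orbT.
have nK p : p \in D -> p \notin K by rewrite in_setD => ->.
have lifts p q : p \in D -> q \in D ->
    exchange_seq M (p |: X1 :\ a, q |: X2 :\ b) s (p |: X2 :\ b, q |: X1 :\ a).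
  move=> pD qD.
  by have [] := exchange_seq_lift (Z := (_, _)) (nK p pD) (nK q qD) (fun Y => @lift p Y pD)
    (fun Y => @lift q Y qD) subK1 subK2 K1 K2 ex.
have base (X : {set E}) p x : basis M X -> x \in X -> (X :\ x) :\: K = set0 ->
    p \in D -> basis M (p |: X :\ x).
  move=> bX' xX /setDD_eq0[sX dX] pD.
  apply: (mincut_basis mD bX') => //; last by rewrite [in RHS](cardsD1 x) xX.
  exact: indepS (subsetDl _ _) (basis_indep bX').
have memX1 : X1 =i a :: unzip1 s.
  by move=> x; rewrite inE -m1 !inE; have [->|] := eqVneq x a.
have memX2 : X2 =i b :: unzip2 s.
  by move=> x; rewrite inE -m2 !inE; have [->|] := eqVneq x b.
have uX1 : uniq (a :: unzip1 s) by rewrite /= -m1 !inE eqxx.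
have uX2 : uniq (b :: unzip2 s) by rewrite /= -m2 !inE eqxx.
have nb : b \notin a |: X1 :\ a by rewrite setD1K.
have na : a \notin b |: X2 :\ b by rewrite setD1K.
have nb' : b \notin X1 :\ a by rewrite inE (negPf bX1') andbF.
have na' : a \notin X2 :\ b by rewrite inE (negPf aX2) andbF.
case: hs => [hD|hs].
  exists (s ++ [:: (a, b)]); split; last first.
    exists s, (a, b); rewrite cats1; split=> //.
    by move: hD; rewrite !inE => /orP[] /eqP; [left | right].
  split.
  - apply/exchange_seq_cat; exists (a |: X2 :\ b, b |: X1 :\ a).
      by have := lifts a b aD bD; rewrite !setD1K.
    exists (b |: X2 :\ b, a |: X1 :\ a); last by rewrite /= !setD1K.
    apply: sym_exchangeU1; rewrite ?base //.
      by rewrite !inE (negPf ab) eqxx.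
    by rewrite !inE eq_sym (negPf ab) eqxx.
  - by rewrite /unzip1 map_cat cats1 rcons_uniq.
  - by rewrite /unzip2 map_cat cats1 rcons_uniq.
  - by move=> x; rewrite /unzip1 map_cat cats1 mem_rcons memX1.
  - by move=> x; rewrite /unzip2 map_cat cats1 mem_rcons memX2.
exists ((a, b) :: s); split; last exact: (last_exchanges_cat [:: (a, b)]).
split=> //.
exists (b |: X1 :\ a, a |: X2 :\ b); last by have := lifts b a bD aD; rewrite !setD1K.
rewrite -{1}(setD1K aX) -{1}(setD1K bX).
by apply: sym_exchangeU1; rewrite ?base ?setD11.
Qed.

(** The step exchanging [b] with [f] in the contraction of [a], split in two.  The
set [c |: T] is independent and smaller by one than the basis
[a |: (b |: T)], so [a] or [b] can be added to it.  The element that is not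
needed there is exchanged with [c], and the other one with [f] afterwards. *)
Lemma two_exchanges a b c f (T S : {set E}) :
    mincut M U [set a; b; c] -> a != b -> c != a -> c != b ->
    T \subset U :\: [set a; b; c] -> S \subset U :\: [set a; b; c] ->
    f \in U :\: [set a; b; c] -> f \notin T -> f \notin S ->
    basis M (a |: (b |: T)) -> basis M (a |: (f |: S)) ->
    basis M (a |: (f |: T)) -> basis M (a |: (b |: S)) ->
  exists y y', ((y, y') = (a, b) \/ (y, y') = (b, a)) /\
    exchange_seq M (a |: (b |: T), c |: (f |: S)) [:: (y, c); (y', f)]
      (c |: (f |: T), a |: (b |: S)).
Proof.
move=> mD ab ca cb sT sS fK fT fS bT bS bT' bS'.
set D := [set a; b; c] in mD sT sS fK.
have nin (X : {set E}) x : X \subset U :\: D -> x \in D -> x \notin X.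
  by move=> sX; apply: contraL => /(subsetP sX); rewrite inE => /andP[].
have [aD bD cD] : [/\ a \in D, b \in D & c \in D] by rewrite !inE !eqxx !orbT.
have nf x : x \in D -> (x == f) = false.
  by move=> xD; apply: contraTF fK => /eqP <-; rewrite inE xD.
have nf' x : x \in D -> (f == x) = false by rewrite eq_sym; apply: nf.
have nT x : x \in D -> (x \in T) = false by move=> xD; apply/negbTE/nin.
have nS x : x \in D -> (x \in S) = false by move=> xD; apply/negbTE/nin.
have cut_basis (X : {set E}) x : X \subset U :\: D -> basis M (a |: X) -> x \in D ->
    basis M (x |: X).
  move=> sX bX xD; move: (sX); rewrite subsetD => /andP[sXU dX].
  apply: (mincut_basis mD bX) => //; last by rewrite cardsU1 (nin _ a).
  exact: indepS (subsetUr _ _) (basis_indep bX).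
have sfT : f |: T \subset U :\: D by rewrite subUset sub1set fK.
have sfS : f |: S \subset U :\: D by rewrite subUset sub1set fK.
have bcT := cut_basis _ c sfT bT' cD.
have icT : c |: T \in indep M.
  by rewrite (indepS _ (basis_indep bcT)) // setUS // subsetUr.
have szT : #|a |: (b |: T)| = #|T|.+2.
  by rewrite !cardsU1 !inE (negPf ab) !nT.
have [|x] := indep_aug icT (basis_indep bT); first by rewrite szT cardsU1 nT.
rewrite !inE negb_or => /andP[/andP[xc xT]]; rewrite (negPf xT) orbF => xab ix.
have {ix} bx : basis M (x |: (c |: T)).
  by rewrite (basisE _ bT) ix szT !cardsU1 !inE (negPf xc) (negPf xT) nT //= !add1n eqxx.
have neq : [/\ b == a = false, a == c = false & b == c = false].
  by rewrite eq_sym (negPf ab) eq_sym (negPf ca) eq_sym (negPf cb).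
case: neq => ba ac bc.
(* [nf], [nf'], [nT] and [nS] have side conditions, which hold for [a], [b], [c]
   only; the facts on [f] must therefore be tried before them. *)
have simp := (inE, eqxx, negPf ab, negPf ca, negPf cb, ba, ac, bc, negPf fT, negPf fS,
  nf, nf', nT, nS, aD, bD, cD).
case/orP: xab => /eqP xE; rewrite {}xE in bx *.
  exists b, a; split; first by right.
  exists (c |: (a |: T), b |: (f |: S)).
    rewrite (setUCA [set a]); apply: sym_exchangeU1; rewrite ?simp //.
    - by rewrite (setUCA [set b]).
    - exact: cut_basis.
    - by rewrite (setUCA [set c]).
    - exact: cut_basis.
  exists (f |: (c |: T), a |: (b |: S)) => //; last by rewrite (setUCA [set c]).
  rewrite (setUCA [set c]) (setUCA [set b]).
  apply: sym_exchangeU1; rewrite ?simp //.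
  - by rewrite (setUCA [set f]); apply: cut_basis.
  - by rewrite (setUCA [set f]).
exists a, b; split; first by left.
exists (c |: (b |: T), a |: (f |: S)).
  apply: sym_exchangeU1; rewrite ?simp //; first exact: cut_basis.
  by rewrite (setUCA [set c]).
exists (f |: (c |: T), b |: (a |: S)); last by rewrite (setUCA [set c]) (setUCA [set a]).
rewrite (setUCA [set c]) (setUCA [set a]).
apply: sym_exchangeU1; rewrite ?simp //.
- by rewrite (setUCA [set f]).
- by rewrite (setUCA [set f]).
- by rewrite (setUCA [set b]).
Qed.

(** The element [b] moves in one step [(b, f)] of [s].  Before it, a basis on the
first side of the contraction contains [b] and is extended by [a], while one on
the second side misses the cut and is extended by [c]; after it the roles are
interchanged.  As [h] is not in the cut, if [(b, f)] is the last step then [h]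
is [f], which is exchanged last in the two steps replacing it. *)
Lemma reversal_cut3 a b c (ia : [set a] \in indep M) s h :
  a \in X1 -> b \in X1 -> c \in X2 -> a != b -> mincut M U [set a; b; c] ->
  h \notin [set a; b; c] -> reversal (contract ia) (X1 :\ a) (X2 :\ c) s ->
  last_exchanges s h -> exists t, reversal M X1 X2 t /\ last_exchanges t h.
Proof.
move=> aX bX cX ab mD hD [ex u1 u2 m1 m2] hs; set D := [set a; b; c] in mD hD.
have aX2 := notin_disjoint aX.
have bX2' := notin_disjoint bX.
have cX1 : c \notin X1 by rewrite (disjointFl disX).
have ca : c != a by apply: contraNneq cX1 => ->.
have cb : c != b by apply: contraNneq cX1 => ->.
have [aD bD cD] : [/\ a \in D, b \in D & c \in D] by rewrite !inE !eqxx !orbT.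
pose K := U :\: D.
have nK p : p \in D -> p \notin K by rewrite in_setD => ->.
have sub1 x : x \in unzip1 s -> x != b -> x \in K.
  rewrite -m1 !inE => /andP[xa xX] xb; rewrite xX (negPf xa) (negPf xb) /= andbT.
  by apply: contraNneq cX1 => <-.
have sub2 x : x \in unzip2 s -> x \in K.
  rewrite -m2 !inE => /andP[xc xX]; rewrite xX (negPf xc) /= orbT andbT orbF.
  by apply/norP; split; [apply: contraNneq aX2 | apply: contraNneq bX2'] => <-.
have memX1 : X1 =i a :: unzip1 s.
  by move=> x; rewrite inE -m1 !inE; have [->|] := eqVneq x a.
have memX2 : X2 =i c :: unzip2 s.
  by move=> x; rewrite inE -m2 !inE; have [->|] := eqVneq x c.
have uX1 : uniq (a :: unzip1 s) by rewrite /= -m1 !inE eqxx.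
have uX2 : uniq (c :: unzip2 s) by rewrite /= -m2 !inE eqxx.
have bs : b \in unzip1 s by rewrite -m1 !inE eq_sym ab.
have K1 : (X1 :\ a) :\: K = [set b].
  apply/setP => x; have [->|xb] := eqVneq x b.
    by rewrite in_setD nK // !inE eqxx eq_sym ab bX.
  rewrite in_setD in_set1 (negPf xb).
  have [|_] := boolP (x \in X1 :\ a); last by rewrite andbF.
  by rewrite m1 => /sub1/(_ xb) ->.
have K2 : (X2 :\ c) :\: K = set0.
  by apply/eqP; rewrite setD_eq0; apply/subsetP => x; rewrite m2 => /sub2.
have [[b' f] /= bfs bb] := mapP bs; rewrite -{b'}bb in bfs.
have [s1 [s2 sE]] : exists s1 s2, s = s1 ++ (b, f) :: s2.
  by case/splitPr: bfs => s1 s2; exists s1, s2.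
have fK : f \in K by apply: sub2; apply/mapP; exists (b, f).
have [s1b s2b] : b \notin unzip1 s1 /\ b \notin unzip1 s2.
  move: u1; rewrite sE /unzip1 map_cat uniq_catC /= mem_cat negb_or.
  by case/andP => /andP[].
have subK1 t : {subset t <= s} -> b \notin unzip1 t -> {subset unzip1 t <= K}.
  move=> ts bt x xt; apply: sub1; last by apply: contraNneq bt => <-.
  by case/mapP: xt => p /ts ps ->; apply: map_f.
have subK2 t : {subset t <= s} -> {subset unzip2 t <= K}.
  by move=> ts x /mapP[p /ts ps ->]; apply: sub2; apply: map_f.
have ss1 : {subset s1 <= s} by move=> x; rewrite sE mem_cat => ->.
have ss2 : {subset s2 <= s} by move=> x; rewrite sE mem_cat inE => ->; rewrite !orbT.
have lifta (N Y : {set E}) : Y :\: K = N -> basis (contract ia) Y -> basis M (a |: Y).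
  by move=> _; rewrite contract_basis => /andP[].
have liftc (Y : {set E}) : Y :\: K = set0 -> basis (contract ia) Y -> basis M (c |: Y).
  by move=> /setDD_eq0[sY dY]; apply: contract_basis_mincut mD sY dY cD.
move: (ex); rewrite sE => /exchange_seq_cat[Z ex1 [Y stepY ex2]].
have [lift1 [Z1 Z2]] := exchange_seq_lift (Z := (_, _)) (nK a aD) (nK c cD) (lifta _) liftc
  (subK1 _ ss1 s1b) (subK2 _ ss1) K1 K2 ex1.
have [[bZ1 bZ2] [e12 f21] [bY1 bY2] YE] := stepY.
have [bZ bZ'] : b \in Z.1 /\ b \notin Z.2 by move: e12; rewrite inE => /andP[].
have [fZ fZ'] : f \in Z.2 /\ f \notin Z.1 by move: f21; rewrite inE => /andP[].
have sT : Z.1 :\ b \subset K.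
  apply/subsetP => x /setD1P[xb xZ]; apply: contraNT xb => xK.
  by rewrite -in_set1 -Z1 in_setD xK.
have sS : Z.2 \subset K by rewrite -setD_eq0 Z2.
have sS' : Z.2 :\ f \subset K by apply: subset_trans sS; apply: subsetDl.
have [| | | | y [y' [yE mid]]] := @two_exchanges a b c f (Z.1 :\ b) (Z.2 :\ f)
    mD ab ca cb sT sS' fK _ _ (lifta _ _ erefl _) (lifta _ _ erefl _)
    (lifta _ _ erefl bY1) (lifta _ _ erefl bY2).
- by rewrite !inE (negPf fZ') andbF.
- by rewrite !inE eqxx.
- by rewrite setD1K.
- by rewrite setD1K.
have Y1 : Y.1 :\: K = set0.
  by apply/eqP; rewrite setD_eq0 YE /swap subUset sub1set fK.
have Y2 : Y.2 :\: K = [set b].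
  apply/setP => x; rewrite YE in_setD in_set1 in_setU1.
  have [->|_] /= := eqVneq x b; first by rewrite nK.
  by have [//|/= xK] := boolP (x \in K); apply: contraNF xK => /setD1P[_ /(subsetP sS)].
have [lift2 _] := exchange_seq_lift (Z := Y) (nK c cD) (nK a aD) liftc (lifta _)
  (subK1 _ ss2 s2b) (subK2 _ ss2) Y1 Y2 ex2.
exists (s1 ++ [:: (y, c); (y', f)] ++ s2); split; last first.
  move: hs; rewrite sE => /last_exchanges_cons[hs|[-> hs]].
    by rewrite catA; apply: last_exchanges_cat.
  exists (s1 ++ [:: (y, c)]), (y', f); split; first by rewrite cats0 -cats1 -catA.
  by right; case: hs => // hb; move: hD; rewrite hb bD.
have p1 : perm_eq (unzip1 (s1 ++ [:: (y, c); (y', f)] ++ s2)) (a :: unzip1 s).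
  rewrite sE /unzip1 !map_cat /=; case: yE => [[-> ->]|[-> ->]].
    by rewrite (perm_catCA _ [:: a]).
  by rewrite -cat_rcons (perm_catCA _ [:: a]) /= cat_rcons.
have p2 : perm_eq (unzip2 (s1 ++ [:: (y, c); (y', f)] ++ s2)) (c :: unzip2 s).
  by rewrite sE /unzip2 !map_cat /= (perm_catCA _ [:: c]).
split.
- rewrite -{1}(setD1K aX) -{1}(setD1K cX).
  apply/exchange_seq_cat; exists (a |: Z.1, c |: Z.2) => //.
  apply/exchange_seq_cat; exists (c |: Y.1, a |: Y.2); last first.
    by move: lift2; rewrite /= !setD1K.
  by move: mid; rewrite !setD1K // YE.
- by rewrite (perm_uniq p1).
- by rewrite (perm_uniq p2).
- by move=> x; rewrite (perm_mem p1) memX1.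
- by move=> x; rewrite (perm_mem p2) memX2.
Qed.

End Step.

(** * The induction *)

(** The statement allows [h] to be any element, since after a contraction along a
cut of size two the element [h] may no longer belong to the two bases. *)
Lemma reversal_exists (V E : finType) (d : E -> {set V}) (M : matroid E)
    (X1 X2 : {set E}) h :
  graph_like d M -> basis M X1 -> basis M X2 -> [disjoint X1 & X2] ->
  exists s, reversal M X1 X2 s /\ (h \in X1 :|: X2 -> last_exchanges s h).
Proof.
have [n] := ubnP #|X1|; elim: n => // n IH in d M X1 X2 h * => szX1 glM bX1 bX2 disX.
have szX := basis_card bX1 bX2.
have [X10|/set0Pn[x0 x0X]] := eqVneq X1 set0.
  have X20 : X2 = set0 by apply/eqP; rewrite -cards_eq0 -szX X10 cards0.
  exists [::]; rewrite X10 X20; split; last by rewrite !inE.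
  by split=> // x; rewrite inE.
wlog hU : h / h \in X1 :|: X2.
  move=> hyp; have [hU|hU] := boolP (h \in X1 :|: X2); first by have := hyp h hU; rewrite hU.
  have [|s [revs _]] := hyp x0; first by rewrite inE x0X.
  by exists s.
have [D0 cutD0 [sD0 szD0]] := low_degree_cut glM bX1 bX2 disX hU.
have [D mD sD] := minset_exists cutD0.
have sDU := subset_trans sD sD0.
have {szD0}szD : #|D| <= 2 \/ #|D| <= 3 /\ h \notin D.
  have le := subset_leq_card sD.
  case: szD0 => [le2|[le3 hD]]; [left | right]; first exact: leq_trans le2.
  by split; [apply: leq_trans le3 | apply: contra hD; apply: subsetP].
have IHa (Y1 Y2 : {set E}) a b : #|Y1| = #|X1| -> basis M Y1 -> basis M Y2 ->
    [disjoint Y1 & Y2] -> mincut M (Y1 :|: Y2) D -> a \in Y1 -> a \in D -> b \in Y2 ->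
    [disjoint Y2 :\ b & D] ->
    exists (ia : [set a] \in indep M) s, reversal (contract ia) (Y1 :\ a) (Y2 :\ b) s /\
      (h \in (Y1 :\ a) :|: (Y2 :\ b) -> last_exchanges s h).
  move=> szY bY1 bY2 disY mDY aY aD bY disD.
  have ia : [set a] \in indep M by rewrite (indepS _ (basis_indep bY1)) ?sub1set.
  have /cards2P[u [v [uv da]]] : #|d a| == 2 by rewrite (graph_like_endset glM ia) ?set11.
  exists ia; apply: (IH _ _ _ _ _ _ (graph_like_contract ia uv da glM)).
  - by move: szX1; rewrite -szY (cardsD1 a Y1) aY.
  - by rewrite contract_basis setD1K // bY1 !inE eqxx.
  - rewrite contract_basis !inE (disjointFr disY aY) andbF /=.
    apply: (mincut_basis mDY bY2) => //.
    + exact: indepS (subsetDl _ _) (basis_indep bY2).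
    + by rewrite [in RHS](cardsD1 b) bY.
    + by apply: subset_trans (subsetUr _ _); apply: subsetDl.
  - by apply: disjointWl (subsetDl _ _) (disjointWr (subsetDl _ _) disY).
have cD : cut M (X1 :|: X2) D := minsetp mD.
have [a aX aD] := cutP _ _ _ cD _ bX1 (subsetUl _ _).
have [b bX bD] := cutP _ _ _ cD _ bX2 (subsetUr _ _).
have ab : a != b by apply: contraTneq bX => <-; rewrite (disjointFr disX).
have [|/set0Pn[c]] := eqVneq (D :\ a :\ b) set0.
  move=> D0'; have DE : D = [set a; b].
    by rewrite -(setD1K aD) -(setD1K (_ : b \in D :\ a)) ?D0' ?setU0 // !inE eq_sym ab.
  have [|ia [s [revs hs]]] := IHa X1 X2 a b erefl bX1 bX2 disX mD aX aD bX.
    rewrite DE; apply/pred0P => x /=; rewrite !inE.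
    have [->|] := eqVneq x b; rewrite //= orbF andbC.
    by have [->|//] := eqVneq x a; rewrite (disjointFr disX).
  rewrite DE in mD.
  have [|t [revt ht]] := reversal_cut2 bX1 bX2 disX aX bX mD revs (h := h); last by exists t.
  have [hD|hD] := boolP (h \in [set a; b]); [by left | right].
  apply: hs; move: hU hD; rewrite !inE negb_or => /orP[] -> /andP[-> ->] //.
  by rewrite orbT.
(* The cut has a third element [c].  If [c] is in [X1], contract [a]; if it is in
   [X2], exchange the roles of the two bases and contract [b]. *)
rewrite !inE => /and3P[cb ca cD'].
have DE : D = [set a; b; c].
  apply/esym/eqP; rewrite eqEcard !subUset !sub1set aD bD cD' /=.
  rewrite setUC cardsU1 cards2 ab !inE negb_or ca cb.
  by case: szD => [/leq_trans->|[]].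
have hD : h \notin D.
  case: szD => [|[]//]; rewrite DE setUC cardsU1 cards2 ab !inE negb_or ca cb //.
move: (subsetP sDU c cD'); rewrite inE => /orP[cX|cX].
  have DE' : D = [set a; c; b] by rewrite DE -!setUA (setUC [set b]).
  have [|ia [s [revs hs]]] := IHa X1 X2 a b erefl bX1 bX2 disX mD aX aD bX.
    rewrite DE; apply/pred0P => x /=; rewrite !inE.
    have [->|_] //= := eqVneq x b; rewrite orbF andbC.
    have [->|_] /= := eqVneq x a; first by rewrite (disjointFr disX).
    by have [->|//] := eqVneq x c; rewrite (disjointFr disX).
  have hs' : last_exchanges s h.
    apply: hs; move: hU hD; rewrite DE !inE !negb_or => /orP[] -> /andP[/andP[-> ->] _] //.
    by rewrite orbT.
  rewrite DE' in mD hD; rewrite eq_sym in ca.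
  by have [t [revt ht]] := reversal_cut3 disX aX cX bX ca mD hD revs hs'; exists t.
have disX' : [disjoint X2 & X1] by rewrite disjoint_sym.
have mD' : mincut M (X2 :|: X1) D by rewrite setUC.
have DE' : D = [set b; c; a] by rewrite DE -setUA setUC.
have [|ia [s [revs hs]]] := IHa X2 X1 b a (esym szX) bX2 bX1 disX' mD' bX bD aX.
  rewrite DE; apply/pred0P => x /=; rewrite !inE.
  have [->|_] //= := eqVneq x a; rewrite andbC.
  have [->|_] /= := eqVneq x b; first by rewrite (disjointFl disX).
  by have [->|//] := eqVneq x c; rewrite (disjointFl disX).
have hs' : last_exchanges s h.
  apply: hs; move: hU hD; rewrite DE !inE !negb_or => /orP[] -> /andP[/andP[-> ->] _] //.
  by rewrite orbT.
rewrite DE' in mD' hD; rewrite eq_sym in cb.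
have [t [revt ht]] := reversal_cut3 disX' bX cX aX cb mD' hD revs hs'.
exists [seq (p.2, p.1) | p <- t].
by split; [apply: reversal_swap | move=> _; apply: last_exchanges_swap].
Qed.

Theorem theorem4p3 (E : finType) (M : matroid E) (r : nat) (X1 X2 : {set E})
    (graphicM : graphic M) (rankM : rank M = r)
    (basisX1 : basis M X1) (basisX2 : basis M X2)
    (disjX : [disjoint X1 & X2])
    (h : E) (hX : h \in X1 :|: X2) :
  exists (s : seq (E * E)) (e f : E),
    [/\ exchange_seq M (X1, X2) (rcons s (e, f)) (X2, X1),
        size (rcons s (e, f)) = r
      & h = e \/ h = f].
Proof.
have [V [G indepE]] := graphicM.
have glM : graph_like (endset G) M.
  split=> [e|A e v /indepE acA e2 ve vA|A /indepE acA]; last exact: acyclic_sparse.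
    by rewrite /endset cards2; case: (_ != _).
  by apply/indepE; apply: acyclic_leaf ve vA.
have [s [[ex u1 _ m1 _] /(_ hX)[s' [[e f] [sE hef]]]]] :=
  reversal_exists h glM basisX1 basisX2 disjX.
exists s', e, f; rewrite -sE; split=> //.
by rewrite -rankM (rank_basis basisX1) (eq_card m1) (card_uniqP u1) size_map.
Qed.
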